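(* Let $A,B\in M_2(\mathbb C)$ be positive semidefinite, let $f$ be a nonnegative nondecreasing function on an interval containing $\operatorname{spec}(A)$, and let $s\geq1$ be real. Then \[ \operatorname{Tr} f(A)A^sB^s\geq\operatorname{Tr} f(A)(A^{1/2}BA^{1/2})^s . \]
   Context: Powers and functions of Hermitian matrices are taken by the functional calculus; $\operatorname{spec}(A)$ is the set of eigenvalues of $A$. *)

(* Defs.v *)
From HB Require Import structures.
From mathcomp Require Import all_boot all_order all_algebra complex.
From mathcomp Require Import all_classical all_reals all_analysis.

Set Implicit Arguments.
Unset Strict Implicit.
Unset Printing Implicit Defensive.

Import Order.TTheory GRing.Theory Num.Theory.
Local Open Scope ring_scope.
Local Open Scope complex_scope.
Local Open Scope sesquilinear_scope.
Local Open Scope classical_set_scope.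

Section Defs.
Context {R : realType} {n : nat}.
Implicit Types (A : 'M[R[i]]_n) (f : R -> R).

(* In [R[i]], [0 <= z] means that z is real and nonnegative. *)
Definition psdmx A : Prop :=
  A \is hermsymmx /\ forall v : 'cV[R[i]]_n, 0 <= (v ^t* *m A *m v) 0 0.

Definition spec A : set R[i] := [set a | eigenvalue A a].

(* For Hermitian A, the entries of [spectral_diag A] are the (real) eigenvalues
   of A, so [Re] only casts them to R. For other matrices the value is junk. *)
Definition hermfun f A : 'M[R[i]]_n :=
  (spectralmx A) ^t*
  *m diag_mx (map_mx (fun z : R[i] => (f (complex.Re z))%:C) (spectral_diag A))
  *m spectralmx A.

(* [hermfun] does not depend on the choice of the diagonalization. *)
Lemma hermfunE f A (U : 'M[R[i]]_n) (d : 'rV[R]_n) : U \is unitarymx ->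
  A = U ^t* *m diag_mx (map_mx (real_complex R) d) *m U ->
  hermfun f A = U ^t* *m diag_mx (map_mx (fun x => (f x)%:C) d) *m U.
Proof.
move=> Uu defA; set V := spectralmx A.
have Vu : V \is unitarymx by exact: spectral_unitarymx.
have UK : U *m U ^t* = 1%:M by exact/unitarymxP.
have VK : V *m V ^t* = 1%:M by exact/unitarymxP.
have UK' : U ^t* *m U = 1%:M by exact/mulmx1C.
have VK' : V ^t* *m V = 1%:M by exact/mulmx1C.
have /orthomx_spectralP : A \is normalmx.
  apply/orthomx_spectral_subproof; exists (U, map_mx (real_complex R) d) => //=.
  by rewrite invmx_unitary.
rewrite -/V invmx_unitary // => specA.
have commW : diag_mx (spectral_diag A) *m (V *m U ^t*) =
    V *m U ^t* *m diag_mx (map_mx (real_complex R) d).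
  have /(congr1 (fun X => V *m X *m U ^t*)) := etrans (esym specA) defA.
  by rewrite !mulmxA VK mul1mx => ->; rewrite -!mulmxA UK mulmx1.
have commfW :
    diag_mx (map_mx (fun z => (f (complex.Re z))%:C) (spectral_diag A)) *m
      (V *m U ^t*) =
    V *m U ^t* *m diag_mx (map_mx (fun x => (f x)%:C) d).
  move: (V *m U ^t*) commW => W /matrixP commW.
  apply/matrixP => j k; have := commW j k.
  rewrite !mul_diag_mx !mul_mx_diag !mxE.
  have [->|W0] := eqVneq (W j k) 0; first by rewrite !mulr0 !mul0r.
  by rewrite mulrC => /(mulfI W0) ->; rewrite mulrC.
move: commfW => /(congr1 (fun X => V ^t* *m X *m U)).
by rewrite /hermfun !mulmxA VK' mul1mx -!mulmxA UK' mulmx1.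
Qed.

(* The real power A^s of a positive semidefinite matrix. *)
Definition mxpow A (s : R) : 'M[R[i]]_n := hermfun (fun x => x `^ s) A.

End Defs.

(* Main.v *)
Require Import Defs.
From mathcomp Require Import all_boot all_order all_algebra complex.
From mathcomp Require Import all_classical all_reals all_analysis.
From mathcomp Require Import ring lra.

(* Diagonalize A = diag(a1, a2) with a1 >= a2 and put
   X = A^s B^s - (A^(1/2) B A^(1/2))^s.  Then
   Tr f(A) X = (f(a1) - f(a2)) X_11 + f(a2) Tr X, so it suffices to show
   X_11 >= 0 and Tr X >= 0.  Scale to a1 = 1, a2 = a and let
   M_a = diag(1, sqrt a) B diag(1, sqrt a).  The eigenvalues x > y of M_a are
   explicit functions of a, and the derivative of (M_a^s)_11 is a nonnegative
   multiple of s (x^s + y^s) (x - y) - (x + y) (x^s - y^s), which is nonnegative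
   because tanh (s t) <= s tanh t.  Hence (M_a^s)_11 increases with a, which is
   X_11 >= 0.  The derivative of Tr M_a^s is s (M_a^s)_22 / a, so
   a^(-s) (M_a^s)_22 decreases, and integrating once more gives Tr X >= 0.
   When M_a is diagonal (in particular for a2 = 0) Jensen's inequality
   (B_kk)^s <= (B^s)_kk is enough. *)

Import Order.TTheory GRing.Theory Num.Theory.
Local Open Scope ring_scope.
Local Open Scope complex_scope.
Local Open Scope classical_set_scope.

(** * Powers and derivatives *)

(** The left end stays open because the functions below are differentiated only at positive
    arguments; the right end is the point [1] with which values are compared. *)
Lemma is_derive_homo {R : realType} (f df : R -> R) (a b : R) :
  (forall x, x \in `]a, b]%R -> is_derive x 1 f (df x)) ->
  (forall x, x \in `]a, b]%R -> 0 <= df x) ->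
  {in `]a, b]%R &, {homo f : x y / x <= y}}.
Proof.
move=> fdf df_ge0.
have sub x : x \in `]a, b[%R -> x \in `]a, b]%R by exact: subset_itv_oo_oc.
apply: ger0_derive1_le_oc.
- by move=> x /sub/fdf[].
- by move=> x /sub xab; rewrite derive1E; case: (fdf x xab) => _ ->;
    exact: df_ge0.
- by apply: derivable_within_continuous => x /fdf[].
Qed.

(* The library states these rules for pointwise operations such as [f + g], which
   do not match explicit functions. *)
Section is_derive_fun.
Context {R : realType}.
Implicit Types (f g : R -> R) (x df dg : R).

Lemma is_derive_fun_cst x (a : R) : is_derive x 1 (fun=> a) 0.
Proof. exact: is_derive_cst. Qed.

Lemma is_derive_fun_id x : is_derive x 1 (fun y => y) 1.
Proof. exact: is_derive_id. Qed.

Lemma is_derive_funD f g x df dg : is_derive x 1 f df -> is_derive x 1 g dg ->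
  is_derive x 1 (fun y => f y + g y) (df + dg).
Proof. exact: is_deriveD. Qed.

Lemma is_derive_funB f g x df dg : is_derive x 1 f df -> is_derive x 1 g dg ->
  is_derive x 1 (fun y => f y - g y) (df - dg).
Proof. exact: is_deriveB. Qed.

Lemma is_derive_funN f x df : is_derive x 1 f df ->
  is_derive x 1 (fun y => - f y) (- df).
Proof. exact: is_deriveN. Qed.

Lemma is_derive_funM f g x df dg : is_derive x 1 f df -> is_derive x 1 g dg ->
  is_derive x 1 (fun y => f y * g y) (f x * dg + g x * df).
Proof. exact: is_deriveM. Qed.

Lemma is_derive_fun_sqr f x df : is_derive x 1 f df ->
  is_derive x 1 (fun y => f y ^+ 2) (2 * f x * df).
Proof.
move=> fdf; apply: is_derive_eq.
by rewrite /GRing.scale/=; ring.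
Qed.

Lemma is_derive_funV f x df : f x != 0 -> is_derive x 1 f df ->
  is_derive x 1 (fun y => (f y)^-1) (- (f x) ^- 2 * df).
Proof. exact: is_deriveV. Qed.

Lemma is_derive_fun_sqrt f x df : 0 < f x -> is_derive x 1 f df ->
  is_derive x 1 (fun y => Num.sqrt (f y)) ((2 * Num.sqrt (f x))^-1 * df).
Proof.
move=> fx0 fdf.
exact: (@is_derive1_comp _ _ _ _ _ _ (is_derive1_sqrt fx0) fdf).
Qed.

Lemma is_derive_fun_powR f x df s : 0 < f x -> is_derive x 1 f df ->
  is_derive x 1 (fun y => f y `^ s) (s * f x `^ (s - 1) * df).
Proof.
move=> fx0 fdf.
exact: (@is_derive1_comp _ _ _ _ _ _ (is_derive1_powR s fx0) fdf).
Qed.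

Lemma is_derive_fun_eq f x df dg : is_derive x 1 f df -> df = dg ->
  is_derive x 1 f dg.
Proof. by move=> ? <-. Qed.

End is_derive_fun.

(** The derivative is an existential variable built up by the rules; side conditions may remain,
    together with one equation identifying it with the stated value. *)
Ltac derive_fun :=
  notypeclasses refine (is_derive_fun_eq _ _ _ _ _ _); [repeat first
  [ eassumption
  | notypeclasses refine (is_derive_fun_cst _ _)
  | notypeclasses refine (is_derive_fun_id _)
  | notypeclasses refine (is_derive_funB _ _ _ _ _ _ _)
  | notypeclasses refine (is_derive_funD _ _ _ _ _ _ _)
  | notypeclasses refine (is_derive_funM _ _ _ _ _ _ _)
  | notypeclasses refine (is_derive_fun_sqr _ _ _ _)
  | notypeclasses refine (is_derive_funV _ _ _ _ _)
  | notypeclasses refine (is_derive_fun_sqrt _ _ _ _ _)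
  | notypeclasses refine (is_derive_fun_powR _ _ _ _ _ _) ]|].

(** The quotient is the value at [p] of the affine interpolant taking [u] at [x] and [v] at [y];
    diagonal entries of powers of 2 x 2 matrices have this shape. *)
Lemma is_derive_chord {R : realType} (p a : R) (x y u v : R -> R)
    (dx dy du dv : R) : x a != y a ->
  is_derive a 1 x dx -> is_derive a 1 y dy ->
  is_derive a 1 u du -> is_derive a 1 v dv ->
  is_derive a 1 (fun b => ((p - y b) * u b + (x b - p) * v b) / (x b - y b))
    (((p - y a) * du + (x a - p) * dv - dy * u a + dx * v a) / (x a - y a) -
     ((p - y a) * u a + (x a - p) * v a) * (dx - dy) / (x a - y a) ^+ 2).
Proof.
move=> xy Dx Dy Du Dv; derive_fun; first by rewrite subr_eq0.
by rewrite /=; field; rewrite subr_eq0.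
Qed.

(** Young's inequality for [t] and [1] with exponents [s] and [s / (s - 1)]. The second exponent
    degenerates at [s = 1], which is treated apart. *)
Lemma bernoulli_powR {R : realType} (s t : R) : 1 <= s -> 0 <= t ->
  1 + s * (t - 1) <= t `^ s.
Proof.
rewrite le_eqVlt => /predU1P[<- t0|s1 t0]; first by rewrite powRr1//; lra.
have s0 : 0 < s by lra.
have := @conjugate_powR _ t 1 s (s / (s - 1)) t0 ler01 s0.
rewrite powR1 mulr1 => /(_ _ _)/wrap[]; first by rewrite divr_gt0; lra.
  by field; lra.
have -> : t `^ s / s + 1 / (s / (s - 1)) = (t `^ s + s - 1) / s by field; lra.
by rewrite ler_pdivlMr//; lra.
Qed.

(** Bernoulli's inequality at [x / p], rescaled by the power of [p]. *)
Lemma powR_tangent_le {R : realType} (s p x : R) : 1 <= s -> 0 < p -> 0 <= x ->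
  p `^ s + s * p `^ (s - 1) * (x - p) <= x `^ s.
Proof.
move=> s1 p0 x0.
have := @bernoulli_powR _ s (x / p) s1 (divr_ge0 x0 (ltW p0)).
have xE : x `^ s = p `^ s * (x / p) `^ s.
  by rewrite -powRM ?(ltW p0) ?divr_ge0 ?(ltW p0)// mulrC divfK ?gt_eqF.
rewrite -(ler_pM2l (powR_gt0 s p0)) -xE; apply: le_trans.
rewrite -[p `^ s](@mulr_powRB1 _ p) ?(ltW p0)//; last by lra.
rewrite le_eqVlt; apply/orP; left; apply/eqP; field; lra.
Qed.

(* With [r = exp (- 2 t)] this reads [tanh (s t) <= s tanh t]. *)
Lemma powR_tanh_le {R : realType} (s r : R) : 1 <= s -> 0 < r -> r <= 1 ->
  (1 + r) * (1 - r `^ s) <= s * (1 + r `^ s) * (1 - r).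
Proof.
move=> s1 r0 r1.
pose g (r : R) := (1 + r) * (1 - r `^ s) - s * (1 + r `^ s) * (1 - r).
pose dg (r : R) := (s + 1) * (1 + (s - 1) * r `^ s - s * r `^ (s - 1)).
(* Since [g 1 = 0], it is enough that [g] increases on []0, 1]]. *)
suff : g r <= g 1 by rewrite /g powR1; lra.
apply: (@is_derive_homo _ g dg 0 1); rewrite ?in_itv/=; try lra.
  move=> x; rewrite in_itv/= => /andP[x0 _].
  have xs : x * x `^ (s - 1) = x `^ s by rewrite mulr_powRB1 ?ltW//; lra.
  rewrite /g; derive_fun => //=.
  by rewrite /dg -xs /GRing.scale/=; ring.
move=> x; rewrite in_itv/= => /andP[x0 _].
have xs : x * x `^ (s - 1) = x `^ s by rewrite mulr_powRB1 ?ltW//; lra.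
apply: mulr_ge0; first by lra.
(* Up to the factor [s + 1], [dg x] is the gap at [1] in the tangent inequality based at [x]. *)
have := @powR_tangent_le _ s x 1 s1 x0 ler01; rewrite powR1 -xs; lra.
Qed.

(** By homogeneity this is [powR_tanh_le] at [r = y / x]; [y = 0] is separate because [r] has to be
    positive. *)
Lemma powR_sum_diff_le {R : realType} (s x y : R) : 1 <= s -> 0 <= y -> y < x ->
  (x + y) * (x `^ s - y `^ s) <= s * (x `^ s + y `^ s) * (x - y).
Proof.
move=> s1; rewrite le_eqVlt => /predU1P[<- x0|y0 yx].
  rewrite powR0; last by lra.
  rewrite addr0 !subr0 addr0 mulrAC -mulrA ler_peMl// mulr_ge0 ?powR_ge0//.
  exact: ltW.
have x0 : 0 < x by lra.
have := @powR_tanh_le _ s (y / x) s1 (divr_gt0 y0 x0).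
rewrite ler_pdivrMr// mul1r => /(_ (ltW yx)).
have yE : y `^ s = x `^ s * (y / x) `^ s.
  by rewrite -powRM ?divr_ge0 ?ltW// mulrC divfK ?gt_eqF.
rewrite yE; set r := y / x; have -> : y = x * r by rewrite mulrC divfK ?gt_eqF.
by rewrite -(ler_pM2l (mulr_gt0 x0 (powR_gt0 s x0))); lra.
Qed.

(** * Powers of a one-parameter family of 2 x 2 matrices *)

Section compression.
Context {R : realType} (p q w s : R).
Hypotheses (p0 : 0 < p) (w0 : 0 < w) (wpq : w <= p * q) (s1 : 1 <= s).
Implicit Types a : R.

Let s0 : 0 < s. Proof. exact: lt_le_trans s1. Qed.

(* For [B = [[p, z], [z^*, q]]] with [w = `|z|^2], these are the eigenvalues of
   [M_a = [[p, sqrt a z], [sqrt a z^*, a q]]]; [pow11 a] and [pow22 a] are the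
   diagonal entries of [M_a ^ s]. The shape of [eigmin] makes it vanish
   identically when [w = p * q]. *)
Definition eigmax a : R :=
  (p + q * a + Num.sqrt ((p - q * a) ^+ 2 + 4 * w * a)) / 2.
Definition eigmin a : R := a * (p * q - w) / eigmax a.
Definition pow11 a : R :=
  ((p - eigmin a) * eigmax a `^ s + (eigmax a - p) * eigmin a `^ s) /
  (eigmax a - eigmin a).
Definition pow22 a : R :=
  ((eigmax a - p) * eigmax a `^ s + (p - eigmin a) * eigmin a `^ s) /
  (eigmax a - eigmin a).

Lemma eigmax_gt a : 0 < a -> p < eigmax a.
Proof.
move=> a0.
have : p - q * a < Num.sqrt ((p - q * a) ^+ 2 + 4 * w * a).
  apply: (le_lt_trans (ler_norm _)); rewrite -sqrtr_sqr ltr_sqrt.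
    by rewrite ltrDl !mulr_gt0.
  by rewrite ltr_wpDl ?sqr_ge0// !mulr_gt0.
rewrite /eigmax; lra.
Qed.

Lemma eigmax_gt0 a : 0 < a -> 0 < eigmax a.
Proof. by move=> /eigmax_gt; exact: lt_trans. Qed.

Lemma eig_mul a : 0 < a -> eigmax a * eigmin a = a * (p * q - w).
Proof. by move=> a0; rewrite mulrC divfK ?gt_eqF ?eigmax_gt0. Qed.

(** Recovers the conjugate-root formula for [eigmin] from its definition as determinant over
    [eigmax]. *)
Lemma eigmax_sub a : 0 < a ->
  eigmax a - eigmin a = Num.sqrt ((p - q * a) ^+ 2 + 4 * w * a).
Proof.
move=> a0; apply: (mulfI (lt0r_neq0 (eigmax_gt0 a a0))).
rewrite mulrBr eig_mul// {1 2}/eigmax; set S := Num.sqrt _.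
have : S ^+ 2 = (p - q * a) ^+ 2 + 4 * w * a.
  by rewrite sqr_sqrtr// addr_ge0 ?sqr_ge0// !mulr_ge0// ltW.
rewrite /eigmax -/S; nra.
Qed.

Lemma eig_add a : 0 < a -> eigmax a + eigmin a = p + q * a.
Proof.
move=> a0; have := eigmax_sub a a0.
have : 2 * eigmax a = p + q * a + Num.sqrt ((p - q * a) ^+ 2 + 4 * w * a).
  by rewrite /eigmax; lra.
lra.
Qed.

Lemma eigmin_ge0 a : 0 < a -> 0 <= eigmin a.
Proof.
move=> a0; apply: divr_ge0; last exact/ltW/eigmax_gt0.
by rewrite mulr_ge0 ?subr_ge0// ltW.
Qed.

(** Strict interlacing: minus the characteristic polynomial of [M_a] at its diagonal entry [p] is
    [a * w], the squared modulus of the off-diagonal entry. *)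
Lemma eigmin_lt a : 0 < a -> eigmin a < p.
Proof.
move=> a0; have sum := eig_add a a0; have prod := eig_mul a a0.
have u0 : 0 < eigmax a - p by rewrite subr_gt0 eigmax_gt.
have : 0 < (eigmax a - p) * (p - eigmin a).
  have -> : (eigmax a - p) * (p - eigmin a) =
      p * (eigmax a + eigmin a) - p ^+ 2 - eigmax a * eigmin a by ring.
  have -> : p * (eigmax a + eigmin a) - p ^+ 2 - eigmax a * eigmin a = a * w.
    by rewrite sum prod; ring.
  exact: mulr_gt0.
by rewrite pmulr_rgt0// subr_gt0.
Qed.

(** Written in the eigenvalues, [p] and [a] only, the formula turns into the one for [eigmin] when
    the eigenvalues are exchanged. *)
Lemma is_derive_eigmax a : 0 < a ->
  is_derive a 1 eigmax
    (eigmax a * (eigmax a - p) / (a * (eigmax a - eigmin a))).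
Proof.
move=> a0; have S0 : 0 < eigmax a - eigmin a.
  by rewrite subr_gt0 (lt_trans (eigmin_lt a a0)) ?eigmax_gt.
have D0 : 0 < (p - q * a) ^+ 2 + 4 * w * a.
  by rewrite ltr_wpDl ?sqr_ge0// !mulr_gt0.
rewrite /eigmax; derive_fun => //=; rewrite -eigmax_sub//.
move: S0 (eig_add a a0) (eig_mul a a0).
move: (eigmax a) (eigmin a) => x y S0 sum prod.
(* Trace and determinant eliminate [q] and [w], leaving a rational identity. *)
have qE : q = (x + y - p) / a by rewrite sum; field; lra.
have wE : w = p * q - x * y / a by rewrite prod; field; lra.
by rewrite wE qE /GRing.scale/=; field; lra.
Qed.

Lemma is_derive_eigmin a : 0 < a ->
  is_derive a 1 eigmin
    (eigmin a * (p - eigmin a) / (a * (eigmax a - eigmin a))).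
Proof.
move=> a0; have S0 : 0 < eigmax a - eigmin a.
  by rewrite subr_gt0 (lt_trans (eigmin_lt a a0)) ?eigmax_gt.
have D := is_derive_eigmax a a0; have x0 := eigmax_gt0 a a0.
have prod := eig_mul a a0.
have x_neq0 : eigmax a != 0 by rewrite gt_eqF.
apply: is_derive_fun_eq (is_derive_funM _ _ _ _ _ (is_derive_funM _ _ _ _ _
  (is_derive_fun_id _) (is_derive_fun_cst _ _))
  (is_derive_funV _ _ _ x_neq0 D)) _.
rewrite /=.
have -> : p * q - w = eigmax a * eigmin a / a by rewrite prod; field; lra.
by rewrite /GRing.scale/=; field; lra.
Qed.

Lemma is_derive_eigmax_powR a : 0 < a ->
  is_derive a 1 (fun b => eigmax b `^ s)
    (s * eigmax a `^ s * (eigmax a - p) / (a * (eigmax a - eigmin a))).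
Proof.
move=> a0; have S0 : 0 < eigmax a - eigmin a.
  by rewrite subr_gt0 (lt_trans (eigmin_lt a a0)) ?eigmax_gt.
have D := is_derive_eigmax a a0; have x0 := eigmax_gt0 a a0.
apply: is_derive_fun_eq (is_derive_fun_powR _ _ _ s x0 D) _.
rewrite -(@mulr_powRB1 _ (eigmax a) s) ?(ltW x0)//.
by field; lra.
Qed.

(* If [w = p * q] then [eigmin] stays at [0], where [powR ^~ s] need not be
   differentiable. *)
Lemma is_derive_eigmin_powR a : 0 < a ->
  is_derive a 1 (fun b => eigmin b `^ s)
    (s * eigmin a `^ s * (p - eigmin a) / (a * (eigmax a - eigmin a))).
Proof.
move=> a0; have S0 : 0 < eigmax a - eigmin a.
  by rewrite subr_gt0 (lt_trans (eigmin_lt a a0)) ?eigmax_gt.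
have D := is_derive_eigmin a a0.
have [wE|wne] := eqVneq w (p * q).
  have y0 b : eigmin b = 0 by rewrite /eigmin wE subrr mulr0 mul0r.
  have -> : (fun b => eigmin b `^ s) = (fun=> 0).
    by apply/funext => b; rewrite y0 powR0// gt_eqF.
  rewrite y0 powR0 ?gt_eqF// mulr0 !mul0r.
  exact: is_derive_fun_cst.
have y0 : 0 < eigmin a.
  rewrite /eigmin divr_gt0 ?eigmax_gt0// mulr_gt0// subr_gt0.
  by rewrite lt_neqAle wne.
apply: is_derive_fun_eq (is_derive_fun_powR _ _ _ s y0 D) _.
rewrite -(@mulr_powRB1 _ (eigmin a) s) ?(ltW y0)//.
by field; lra.
Qed.

(** The derivative of [pow11], factored to show its sign: the first factor is positive by
    interlacing, the second is the gap in [powR_sum_diff_le]. *)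
Definition dpow11 a : R :=
  (eigmax a - p) * (p - eigmin a) / (a * (eigmax a - eigmin a) ^+ 3) *
  (s * (eigmax a `^ s + eigmin a `^ s) * (eigmax a - eigmin a) -
   (eigmax a + eigmin a) * (eigmax a `^ s - eigmin a `^ s)).

Lemma dpow11_ge0 a : 0 < a -> 0 <= dpow11 a.
Proof.
move=> a0; have u0 := eigmax_gt a a0; have v0 := eigmin_lt a a0.
apply: mulr_ge0.
  apply: divr_ge0; first by apply: mulr_ge0; lra.
  by apply: mulr_ge0; [lra|apply: exprn_ge0; lra].
by rewrite subr_ge0 powR_sum_diff_le ?eigmin_ge0//; lra.
Qed.

Lemma is_derive_pow11 a : 0 < a -> is_derive a 1 pow11 (dpow11 a).
Proof.
move=> a0; have u0 := eigmax_gt a a0; have v0 := eigmin_lt a a0.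
have xy : eigmax a != eigmin a by rewrite gt_eqF ?(lt_trans v0).
apply: is_derive_fun_eq (is_derive_chord p a _ _ _ _ _ _ _ _ xy
  (is_derive_eigmax a a0) (is_derive_eigmin a a0)
  (is_derive_eigmax_powR a a0) (is_derive_eigmin_powR a a0)) _.
rewrite /dpow11; move: (eigmax a) (eigmin a) u0 v0 {xy} => x y u0 v0.
by move: (x `^ s) (y `^ s) => u v; field; lra.
Qed.

(** Equivalently, the trace [pow11 + pow22] has derivative [s * pow22 a / a]. *)
Lemma is_derive_pow22 a : 0 < a ->
  is_derive a 1 pow22 (s * pow22 a / a - dpow11 a).
Proof.
move=> a0; have u0 := eigmax_gt a a0; have v0 := eigmin_lt a a0.
(* With the eigenvalues exchanged but not their powers, [pow22] is again an interpolant evaluated at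
   [p]. *)
have pow22E : pow22 = (fun b =>
    ((p - eigmax b) * eigmax b `^ s + (eigmin b - p) * eigmin b `^ s) /
    (eigmin b - eigmax b)).
  apply/funext => b; rewrite /pow22 -(opprB (eigmax b) (eigmin b)).
  by rewrite invrN mulrN -mulNr; congr (_ * _); ring.
have yx : eigmin a != eigmax a by rewrite lt_eqF ?(lt_trans v0).
rewrite {1}pow22E.
apply: is_derive_fun_eq (is_derive_chord p a _ _ _ _ _ _ _ _ yx
  (is_derive_eigmin a a0) (is_derive_eigmax a a0)
  (is_derive_eigmax_powR a a0) (is_derive_eigmin_powR a a0)) _.
rewrite /pow22 /dpow11; move: (eigmax a) (eigmin a) u0 v0 {yx} => x y u0 v0.
by move: (x `^ s) (y `^ s) => u v; field; lra.
Qed.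

Lemma pow11_le a : 0 < a -> a <= 1 -> pow11 a <= pow11 1.
Proof.
move=> a0 a1.
apply: (@is_derive_homo _ pow11 dpow11 0 1); rewrite ?in_itv/=; try lra.
- by move=> x; rewrite in_itv/= => /andP[x0 _]; exact: is_derive_pow11.
- by move=> x; rewrite in_itv/= => /andP[x0 _]; exact: dpow11_ge0.
Qed.

(** Dividing [pow22] by the power of [a] cancels the term [s * pow22 a / a] of its derivative; only
    a nonpositive multiple of [dpow11] is left. *)
Lemma pow22_ge a : 0 < a -> a <= 1 -> a `^ s * pow22 1 <= pow22 a.
Proof.
move=> a0 a1.
suff : - (pow22 a / a `^ s) <= - (pow22 1 / 1 `^ s).
  by rewrite powR1 divr1 lerN2 ler_pdivlMr ?powR_gt0// mulrC.
apply: (@is_derive_homo _ (fun a => - (pow22 a / a `^ s))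
  (fun a => dpow11 a / a `^ s) 0 1); rewrite ?in_itv/=; try lra.
- move=> x; rewrite in_itv/= => /andP[x0 _]; have D := is_derive_pow22 x x0.
  have xs := powR_gt0 s x0.
  have Dv := is_derive_funV (fun y => y `^ s) _ _ (lt0r_neq0 xs)
    (is_derive_fun_powR _ _ _ s x0 (is_derive_fun_id x)).
  apply: is_derive_fun_eq (is_derive_funN _ _ _
    (is_derive_funM _ _ _ _ _ D Dv)) _.
  rewrite -(@mulr_powRB1 _ x s) ?(ltW x0)//.
  have := powR_gt0 (s - 1) x0; move=> ?; field; lra.
- move=> x; rewrite in_itv/= => /andP[x0 _].
  by rewrite divr_ge0 ?powR_ge0 ?dpow11_ge0.
Qed.

(** Moving the last term to the left gives a function of [a] whose value at [1] is [pow11 1] and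
    whose derivative is nonnegative by [pow22_ge]. *)
Lemma pow11_add_pow22_le a : 0 < a -> a <= 1 ->
  pow11 a + pow22 a <= pow11 1 + a `^ s * pow22 1.
Proof.
move=> a0 a1.
suff : pow11 a + pow22 a - a `^ s * pow22 1 <=
    pow11 1 + pow22 1 - 1 `^ s * pow22 1.
  by rewrite powR1; lra.
apply: (@is_derive_homo _ (fun a => pow11 a + pow22 a - a `^ s * pow22 1)
  (fun a => s / a * (pow22 a - a `^ s * pow22 1)) 0 1);
  rewrite ?in_itv/=; try lra.
- move=> x; rewrite in_itv/= => /andP[x0 _]; have D := is_derive_pow22 x x0.
  have D' := is_derive_pow11 x x0.
  have Dp := is_derive_fun_powR _ _ _ s x0 (is_derive_fun_id x).
  apply: is_derive_fun_eq (is_derive_funB _ _ _ _ _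
    (is_derive_funD _ _ _ _ _ D' D)
    (is_derive_funM _ _ _ _ _ Dp (is_derive_fun_cst _ (pow22 1)))) _.
  rewrite /= -(@mulr_powRB1 _ x s) ?(ltW x0)//.
  by field; lra.
- move=> x; rewrite in_itv/= => /andP[x0 x1].
  by apply: mulr_ge0; [rewrite divr_ge0// ltW | rewrite subr_ge0 pow22_ge].
Qed.

End compression.

(** * Functional calculus *)

Local Open Scope sesquilinear_scope.

Section hermfun.
Context {R : realType} {n : nat}.
Implicit Types (M U : 'M[R[i]]_n) (g : R -> R) (d : 'rV[R]_n).

Lemma unitarymxPl U : U \is unitarymx -> U ^t* *m U = 1%:M.
Proof. by move=> /unitarymxP/mulmx1C. Qed.

Lemma hermsymmxP M : reflect (forall i j, M j i = (M i j)^*%C) (M \is hermsymmx).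
Proof.
apply: (iffP (is_hermitianmxP _ _ _)); rewrite expr0 scale1r.
  by move=> ME i j; rewrite {1}ME !mxE.
by move=> ME; apply/matrixP => i j; rewrite !mxE; exact: ME.
Qed.

Lemma hermsymmx_spectral M : M \is hermsymmx ->
  exists d : 'rV[R]_n,
    M = (spectralmx M) ^t* *m diag_mx (map_mx (real_complex R) d)
                *m spectralmx M.
Proof.
move=> Mh; have /orthomx_spectralP := hermitian_normalmx Mh.
rewrite invmx_unitary ?spectral_unitarymx// => ME.
exists (map_mx (@complex.Re R) (spectral_diag M)); rewrite {1}ME.
congr (_ *m diag_mx _ *m _); apply/rowP => k; rewrite !mxE.
by rewrite RRe_real// (mxOverP (hermitian_spectral_diag_real Mh)).
Qed.

(** If [V] diagonalizes [M], then [V *m U] diagonalizes the conjugate, and [hermfunE] accepts any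
    diagonalization. *)
Lemma hermfun_conj g M U : U \is unitarymx -> M \is hermsymmx ->
  hermfun g (U ^t* *m M *m U) = U ^t* *m hermfun g M *m U.
Proof.
move=> Uu /hermsymmx_spectral[d ME].
set V := spectralmx M in ME.
have Vu : V \is unitarymx by exact: spectral_unitarymx.
rewrite (hermfunE g Vu ME) ME.
rewrite (@hermfunE _ _ _ _ (V *m U) d) ?mul_unitarymx//.
  by rewrite trmx_mul map_mxM !mulmxA.
by rewrite trmx_mul map_mxM !mulmxA.
Qed.

Lemma hermfun_diag g d : hermfun g (diag_mx (map_mx (real_complex R) d)) =
  diag_mx (map_mx (fun x => (g x)%:C) d).
Proof.
have u1 : (1%:M : 'M[R[i]]_n) \is unitarymx.
  by apply/unitarymxP; rewrite trmx1 map_mx1 mulmx1.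
by rewrite (@hermfunE _ _ _ _ 1%:M d) ?trmx1 ?map_mx1 ?mul1mx ?mulmx1.
Qed.

Lemma psdmx_conj M U : psdmx M -> psdmx (U *m M *m U ^t*).
Proof.
move=> [/hermsymmxP Mh M_ge0]; split; last first.
  move=> v; have := M_ge0 (U ^t* *m v).
  by rewrite trmx_mul map_mxM trmxCK !mulmxA.
apply/is_hermitianmxP; rewrite expr0 scale1r.
rewrite !trmx_mul !map_mxM trmxCK mulmxA; congr (_ *m _ *m _).
by apply/matrixP => i j; rewrite !mxE; exact: Mh.
Qed.

Lemma psdmx_diag_ge0 M k : psdmx M -> 0 <= M k k.
Proof.
move=> [_ /(_ (delta_mx k 0))]; rewrite trmx_delta map_delta_mx.
by rewrite -rowE -colE !mxE.
Qed.

(** The eigenvalues are the diagonal entries of a unitary conjugate of [M], which is again positive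
    semidefinite. *)
Lemma psdmx_spectral M : psdmx M ->
  exists2 d : 'rV[R]_n, (forall k, 0 <= d 0 k) &
   M = (spectralmx M) ^t* *m diag_mx (map_mx (real_complex R) d) *m spectralmx M.
Proof.
move=> Mp; have [d ME] := hermsymmx_spectral M (proj1 Mp); exists d => // k.
have := psdmx_diag_ge0 _ k (psdmx_conj _ (spectralmx M) Mp).
set V := spectralmx M in ME *.
have /unitarymxP VK : V \is unitarymx by exact: spectral_unitarymx.
rewrite ME !mulmxA VK mul1mx -mulmxA VK mulmx1 !mxE eqxx mulr1n.
by rewrite ler0c.
Qed.

Lemma psdmx_det_ge0 M : psdmx M -> 0 <= \det M.
Proof.
move=> /psdmx_spectral[d d0 ->].
set V := spectralmx M.
have Vu : V \is unitarymx by exact: spectral_unitarymx.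
rewrite !det_mulmx mulrAC -det_mulmx unitarymxPl// det1 mul1r det_diag.
by apply: prodr_ge0 => k _; rewrite mxE ler0c.
Qed.

End hermfun.

Lemma conj_diag_mxE {R : realType} (n : nat) (V : 'M[R[i]]_n) (e : 'rV[R[i]]_n) k :
  (V ^t* *m diag_mx e *m V) k k = \sum_l (V l k)^*%C * V l k * e 0 l.
Proof.
rewrite mxE; apply: eq_bigr => l _.
by rewrite mul_mx_diag !mxE mulrAC.
Qed.

(** Jensen's inequality: [M k k] averages the eigenvalues with weights given by the squared moduli
    of column [k] of [V], which sum to 1. *)
Lemma psdmx_powR_le {R : realType} (n : nat) (M : 'M[R[i]]_n) (s : R) k :
  psdmx M -> 1 <= s -> (complex.Re (M k k) `^ s)%:C <= mxpow M s k k.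
Proof.
move=> Mp s1; have [d d0 ME] := psdmx_spectral _ Mp.
have pE : (complex.Re (M k k))%:C = M k k.
  by rewrite RRe_real// ger0_real// psdmx_diag_ge0.
move: (psdmx_diag_ge0 _ k Mp) (pE); rewrite -{1}pE ler0c.
move: (complex.Re _) => p p0 {}pE.
set V := spectralmx M in ME.
have Vu : V \is unitarymx by exact: spectral_unitarymx.
rewrite /mxpow (hermfunE _ Vu ME) conj_diag_mxE.
have c_ge0 l : 0 <= (V l k)^*%C * V l k by rewrite mulrC mulcJ_ge0.
have c_sum : \sum_l (V l k)^*%C * V l k = 1.
  have -> : 1 = (V ^t* *m V) k k by rewrite unitarymxPl// mxE eqxx.
  by rewrite mxE; apply: eq_bigr => l _; rewrite !mxE.
(* The tangent at [p] needs [p > 0]; for [p = 0] the left side is [0] because [s > 0]. *)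
move: p0; rewrite le_eqVlt => /predU1P[<-|p0].
  rewrite powR0; last by rewrite gt_eqF ?(lt_le_trans ltr01).
  by apply: sumr_ge0 => l _; rewrite mxE mulr_ge0// ler0c powR_ge0.
(* The average of the tangent line at the mean [p] is its value there, as the linear term averages
   to zero. *)
have -> : (p `^ s)%:C = \sum_l (V l k)^*%C * V l k *
    (p `^ s + s * p `^ (s - 1) * (d 0 l - p))%:C.
  move: pE; rewrite {1}ME conj_diag_mxE => pE.
  under eq_bigr do rewrite rmorphD rmorphM rmorphB mulrDr mulrBr mulrBr.
  rewrite big_split/= -mulr_suml c_sum mul1r.
  rewrite big_split/= sumrN.
  have -> : \sum_l (V l k)^*%C * V l k * ((s * p `^ (s - 1))%:C * (d 0 l)%:C) =
     (s * p `^ (s - 1))%:C * p%:C.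
    rewrite pE mulr_sumr; apply: eq_bigr => l _; rewrite !mxE; ring.
  by rewrite -mulr_suml c_sum mul1r subrr addr0.
apply: ler_sum => l _; rewrite mxE ler_wpM2l// lecR.
exact: powR_tangent_le.
Qed.

(** * Functional calculus of 2 x 2 matrices *)

Lemma ord2_neq (i j : 'I_2) : i != j -> (i = 0 /\ j = 1) \/ (i = 1 /\ j = 0).
Proof.
by case: i j => [[|[|//]] ?] [[|[|//]] ?]//= _; [left|right];
  split; exact: val_inj.
Qed.

(** Stated for any two distinct indices, so that [i] can later be the index of the larger
    eigenvalue. *)
Lemma sum_ord2 {V : nmodType} (F : 'I_2 -> V) (i j : 'I_2) : i != j ->
  \sum_k F k = F i + F j.
Proof.
rewrite 2!big_ord_recl big_ord0 addr0.
by move=> /ord2_neq[[-> ->]|[-> ->]]; last rewrite addrC;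
  congr (F _ + F _); exact: val_inj.
Qed.

Lemma det_ord2 {R : comNzRingType} (M : 'M[R]_2) (i j : 'I_2) : i != j ->
  \det M = M i i * M j j - M i j * M j i.
Proof.
move=> ij; rewrite (expand_det_row M i) (sum_ord2 _ _ _ ij) /cofactor !det_mx11.
rewrite !mxE; case: (ord2_neq _ _ ij) => -[-> ->].
  rewrite expr0 expr1 mul1r mulN1r mulrN.
  by congr (_ * M _ _ - _ * M _ _); exact: val_inj.
rewrite -signr_odd/= expr0 expr1 mul1r mulN1r mulrN.
by congr (_ * M _ _ - _ * M _ _); exact: val_inj.
Qed.

(* On a two-point spectrum [{x, y}] every function is affine. *)
Lemma hermfun_ord2 {R : realType} (M : 'M[R[i]]_2) (g : R -> R) (x y : R) :
  M \is hermsymmx -> x != y -> \tr M = (x + y)%:C -> \det M = (x * y)%:C ->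
  hermfun g M = ((g x - g y) / (x - y))%:C *: M
                + ((x * g y - y * g x) / (x - y))%:C%:M.
Proof.
move=> Mh xy trM detM; have [d ME] := hermsymmx_spectral _ Mh.
set V := spectralmx M in ME.
have Vu : V \is unitarymx by exact: spectral_unitarymx.
have VK := unitarymxPl _ Vu; have /unitarymxP VK' := Vu.
have i01 : (0 : 'I_2) != 1 by [].
have d_sum : d 0 0 + d 0 1 = x + y.
  apply: complexI; rewrite -trM ME -mulmxA mxtrace_mulC -mulmxA VK' mulmx1.
  by rewrite mxtrace_diag (sum_ord2 _ _ _ i01) !mxE rmorphD.
have d_prod : d 0 0 * d 0 1 = x * y.
  apply: complexI; rewrite -detM ME !det_mulmx mulrAC -det_mulmx VK det1 mul1r.
  by rewrite det_diag !big_ord_recl big_ord0 mulr1 !mxE rmorphM;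
    congr (_ * (d _ _)%:C); exact: val_inj.
(* By Vieta, each eigenvalue is a root of the polynomial with roots [x] and [y]. *)
have d_root k : (d 0 k == x) || (d 0 k == y).
  rewrite -[d 0 k == x]subr_eq0 -[d 0 k == y]subr_eq0 -mulf_eq0.
  have [->|->] : d 0 k = d 0 0 \/ d 0 k = d 0 1.
    by case: k => [[|[|//]] ?]; [left|right]; congr (d _ _); exact: val_inj.
  - apply/eqP; transitivity (d 0 0 ^+ 2 - (x + y) * d 0 0 + x * y); first by ring.
    by rewrite -d_sum -d_prod; ring.
  - apply/eqP; transitivity (d 0 1 ^+ 2 - (x + y) * d 0 1 + x * y); first by ring.
    by rewrite -d_sum -d_prod; ring.
rewrite (hermfunE _ Vu ME) {1}ME.
have -> : map_mx (fun x => (g x)%:C) d =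
    ((g x - g y) / (x - y))%:C *: map_mx (real_complex R) d
    + const_mx ((x * g y - y * g x) / (x - y))%:C.
  apply/rowP => k; rewrite !mxE -rmorphM -rmorphD; congr (_ %:C).
  by have /orP[/eqP->|/eqP->] := d_root k; field; rewrite subr_eq0.
rewrite raddfD/= linearZ/= diag_const_mx mulmxDr mulmxDl.
by rewrite -scalemxAr -scalemxAl mul_mx_scalar -scalemxAl VK scalemx1.
Qed.

(** The eigenvalues are [c * x] and [c * y]. Pulling out the scale [c] leaves the shape of [pow11]
    for [m = p] and of [pow22] for [m = x + y - p]. *)
Lemma mxpow_ord2 {R : realType} (M : 'M[R[i]]_2) (i j : 'I_2) (s c x y m : R) :
  i != j -> M \is hermsymmx -> 0 < c -> 0 <= y -> y < x ->
  M i i = (c * m)%:C -> M j j = (c * (x + y - m))%:C ->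
  \det M = (c ^+ 2 * (x * y))%:C ->
  mxpow M s i i =
  (c `^ s * (((m - y) * x `^ s + (x - m) * y `^ s) / (x - y)))%:C.
Proof.
move=> ij Mh c0 y0 yx Mii Mjj detM.
have cxy : c * x != c * y by rewrite (inj_eq (mulfI _)) ?gt_eqF.
rewrite /mxpow (hermfun_ord2 _ _ _ _ Mh cxy); first last.
- by rewrite detM; congr _%:C; ring.
- by rewrite /mxtrace (sum_ord2 _ _ _ ij) Mii Mjj -rmorphD; congr _%:C; ring.
rewrite !mxE eqxx mulr1n Mii -rmorphM -rmorphD; congr _%:C.
have x0 : 0 <= x by rewrite (le_trans y0)// ltW.
rewrite !powRM ?(ltW c0)//; field.
by rewrite -mulrBr mulf_neq0 ?subr_eq0 ?gt_eqF.
Qed.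

(** * The trace inequality for diagonal A *)

(** This is [D^(1/2) B D^(1/2)] for the diagonal matrix [D] with entries [d]. *)
Definition dcongr {R : realType} {n : nat} (d : 'I_n -> R) (B : 'M[R[i]]_n) :=
  \matrix_(k, l) ((Num.sqrt (d k))%:C * B k l * (Num.sqrt (d l))%:C).

Lemma dcongr_diag {R : realType} {n : nat} (d : 'I_n -> R) (B : 'M[R[i]]_n) k :
  0 <= d k -> dcongr d B k k = (d k)%:C * B k k.
Proof. by move=> d0; rewrite mxE mulrAC -rmorphM -expr2 sqr_sqrtr. Qed.

Lemma dcongr_hermsymmx {R : realType} {n : nat} (d : 'I_n -> R) (B : 'M[R[i]]_n) :
  B \is hermsymmx -> dcongr d B \is hermsymmx.
Proof.
move=> /hermsymmxP Bsym; apply/hermsymmxP => k l.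
by rewrite !mxE Bsym !rmorphM/= oppr0 !complexr0; ring.
Qed.

(** The theorem in an eigenbasis of [A]: [d] lists the eigenvalues, [g] the values of [f] at them,
    and [i] is the index of the larger one. *)
Lemma trace_ineq_diag {R : realType} (B : 'M[R[i]]_2) (d g : 'I_2 -> R)
    (i j : 'I_2) (s : R) :
  psdmx B -> i != j -> 0 <= d j <= d i -> 0 <= g j <= g i -> 1 <= s ->
  (g i)%:C * mxpow (dcongr d B) s i i + (g j)%:C * mxpow (dcongr d B) s j j <=
  (g i * d i `^ s)%:C * mxpow B s i i + (g j * d j `^ s)%:C * mxpow B s j j.
Proof.
move=> Bp ij /andP[dj0 dij] /andP[gj0 gij] s1.
have s0 : 0 < s by exact: lt_le_trans s1.
have di0 := le_trans dj0 dij; have gi0 := le_trans gj0 gij.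
have Bh := proj1 Bp; have /hermsymmxP Bsym := Bh.
have BE k : B k k = (complex.Re (B k k))%:C.
  by rewrite RRe_real// ger0_real// psdmx_diag_ge0.
have d0 k : 0 <= d k.
  by case: (ord2_neq _ _ ij) => -[? ?]; subst; case: k => [[|[|//]] ?];
    [move: di0|move: dj0|move: dj0|move: di0]; congr (0 <= d _); exact: val_inj.
have Ch := dcongr_hermsymmx d B Bh.
(* If the compressed matrix is diagonal, its power is taken entrywise and Jensen's inequality for
   [B] suffices. *)
have [offdiag|] := pselect (forall k l, k != l -> dcongr d B k l = 0).
  have -> : dcongr d B = diag_mx (map_mx (real_complex R)
      (\row_k (d k * complex.Re (B k k)))).
    apply/matrixP => k l; rewrite [RHS]mxE !mxE.
    have [<-|kl] := eqVneq k l; last by have := offdiag _ _ kl; rewrite mxE.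
    by have := dcongr_diag d B k (d0 k); rewrite mxE => ->; rewrite BE -rmorphM.
  have Re_ge0 k : 0 <= complex.Re (B k k) by rewrite -ler0c -BE psdmx_diag_ge0.
  have diagE k : mxpow (diag_mx (map_mx (real_complex R)
      (\row_k (d k * complex.Re (B k k))))) s k k =
      (d k `^ s)%:C * (complex.Re (B k k) `^ s)%:C.
    by rewrite /mxpow hermfun_diag !mxE eqxx mulr1n powRM// rmorphM.
  rewrite !diagE !rmorphM !mulrA.
  by apply: lerD; (apply: ler_wpM2l; last exact: psdmx_powR_le);
    rewrite -rmorphM ler0c mulr_ge0 ?powR_ge0.
(* Now [d j] and [B i j * B j i] are positive, since otherwise every off-diagonal entry would
   vanish. This puts the matrix in the one-parameter family. *)
move=> offdiag.
have dj_gt0 : 0 < d j.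
  rewrite lt_neqAle dj0 andbT; apply/eqP => dj; apply: offdiag => k l kl.
  rewrite mxE; case: (ord2_neq _ _ ij) (ord2_neq _ _ kl) => -[? ?] [] [? ?]; subst;
    by rewrite -dj sqrtr0 ?mul0r ?mulr0.
have di_gt0 := lt_le_trans dj_gt0 dij.
set w := complex.Re (B i j * B j i).
have wE : B i j * B j i = w%:C.
  by rewrite RRe_real// ger0_real// (Bsym i j) mulcJ_ge0.
have w0 : 0 < w.
  have : 0 <= w by rewrite -ler0c -wE (Bsym i j) mulcJ_ge0.
  rewrite le_eqVlt => /predU1P[w0|//]; case: offdiag => k l kl.
  have Bij : B i j = 0.
    apply/eqP; rewrite -[_ == 0]orbb -{2}conjc_eq0 -mulf_eq0.
    by rewrite -Bsym wE -w0.
  have Bji : B j i = 0 by rewrite (Bsym i j) Bij conjc0.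
  rewrite mxE; case: (ord2_neq _ _ ij) (ord2_neq _ _ kl) => -[? ?] [] [? ?]; subst;
    by rewrite ?Bij ?Bji mulr0 mul0r.
move: (psdmx_diag_ge0 _ i Bp) (psdmx_diag_ge0 _ j Bp) (psdmx_det_ge0 _ Bp).
have detB := det_ord2 B _ _ ij.
rewrite detB wE.
move: (BE i) (BE j).
move: (complex.Re (B i i)) (complex.Re (B j j)) => p q pE qE.
rewrite pE qE -rmorphM -rmorphB !ler0c subr_ge0 => p_ge0 q_ge0 wpq.
have p0 : 0 < p.
  rewrite lt_neqAle p_ge0 andbT; apply/eqP => p0.
  by move: wpq; rewrite -p0 mul0r leNgt w0.
(* Scaling out [d i] leaves the parameter [a] in []0, 1]]. *)
pose a := d j / d i.
have a0 : 0 < a by rewrite divr_gt0.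
have a1 : a <= 1 by rewrite ler_pdivrMr// mul1r.
have djE : d j = d i * a by rewrite mulrC divfK ?gt_eqF.
pose x b := eigmax p q w b; pose y b := eigmin p q w b.
have yx b : 0 < b -> y b < x b.
  by move=> b0; rewrite (lt_trans (eigmin_lt _ _ _ p0 w0 _ b0))// eigmax_gt.
have y0 b : 0 < b -> 0 <= y b by move=> b0; exact: eigmin_ge0.
have sumE b : 0 < b -> x b + y b - p = q * b.
  by move=> b0; rewrite (eig_add _ _ _ p0 w0 _ b0) addrAC subrr add0r.
have mulE b : 0 < b -> x b * y b = b * (p * q - w).
  by move=> b0; exact: eig_mul.
have ji : j != i by rewrite eq_sym.
(* [B] has the diagonal and determinant of [M_1], and these determine the diagonal of the power. *)
have Bii : mxpow B s i i = (pow11 p q w s 1)%:C.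
  rewrite (mxpow_ord2 _ i j s 1 (x 1) (y 1) p)// ?y0 ?yx//.
  - by rewrite powR1 mul1r.
  - by rewrite pE mul1r.
  - by rewrite qE sumE// mul1r mulr1.
  - by rewrite detB wE pE qE mulE// -rmorphM -rmorphB expr1n !mul1r.
have Bjj : mxpow B s j j = (pow22 p q w s 1)%:C.
  rewrite (mxpow_ord2 _ j i s 1 (x 1) (y 1) (x 1 + y 1 - p))// ?y0 ?yx//.
  - by rewrite powR1 mul1r /pow22 -/(x 1) -/(y 1); congr _%:C; congr (_ / _); ring.
  - by rewrite qE sumE// mul1r mulr1.
  - by rewrite pE mul1r; congr _%:C; ring.
  - by rewrite detB wE pE qE mulE// -rmorphM -rmorphB expr1n !mul1r.
have Cii : dcongr d B i i = (d i * p)%:C by rewrite dcongr_diag// pE -rmorphM.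
have Cjj : dcongr d B j j = (d i * (x a + y a - p))%:C.
  by rewrite dcongr_diag// qE -rmorphM sumE// djE; congr _%:C; ring.
have detC : \det (dcongr d B) = (d i ^+ 2 * (x a * y a))%:C.
  rewrite (det_ord2 _ _ _ ij) Cii Cjj !mxE.
  have -> : forall u v : R[i], u * B i j * v * (v * B j i * u) =
     (u ^+ 2 * v ^+ 2) * (B i j * B j i) by move=> u v; ring.
  rewrite wE -!rmorphXn !sqr_sqrtr// -!rmorphM -rmorphB sumE// mulE// djE.
  by congr _%:C; ring.
have Cpii : mxpow (dcongr d B) s i i = (d i `^ s * pow11 p q w s a)%:C.
  by rewrite (mxpow_ord2 _ i j s (d i) (x a) (y a) p)// ?y0 ?yx.
have Cpjj : mxpow (dcongr d B) s j j = (d i `^ s * pow22 p q w s a)%:C.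
  rewrite (mxpow_ord2 _ j i s (d i) (x a) (y a) (x a + y a - p))// ?y0 ?yx//.
    by rewrite /pow22 -/(x a) -/(y a); congr _%:C; congr (_ * (_ / _)); ring.
  by rewrite Cii; congr _%:C; ring.
rewrite Bii Bjj Cpii Cpjj -!rmorphM -!rmorphD lecR djE powRM ?(ltW a0)//.
have h1 : pow11 p q w s a <= pow11 p q w s 1 by exact: pow11_le.
have h2 : pow11 p q w s a + pow22 p q w s a <=
    pow11 p q w s 1 + a `^ s * pow22 p q w s 1.
  by exact: pow11_add_pow22_le.
move: (powR_ge0 (d i) s); move: (d i `^ s) => D D0.
rewrite -subr_ge0.
(* Summation by parts: the weights [g i - g j] and [g j] are nonnegative and multiply the gaps in
   the first entry and in the trace. *)
have -> : g i * D * pow11 p q w s 1 + g j * (D * a `^ s) * pow22 p q w s 1 -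
   (g i * (D * pow11 p q w s a) + g j * (D * pow22 p q w s a)) =
   D * ((g i - g j) * (pow11 p q w s 1 - pow11 p q w s a) +
   g j * (pow11 p q w s 1 + a `^ s * pow22 p q w s 1 -
     (pow11 p q w s a + pow22 p q w s a))) by ring.
by apply: mulr_ge0 => //; apply: addr_ge0; apply: mulr_ge0; rewrite ?subr_ge0.
Qed.

(** * Reduction to diagonal A by unitary invariance *)

(** Row [k] of [U] is an eigenvector, eigenvectors here being row vectors. *)
Lemma eigenvalue_unitary_diag {R : realType} (n : nat) (U : 'M[R[i]]_n)
    (e : 'rV[R[i]]_n) k : U \is unitarymx ->
  eigenvalue (U ^t* *m diag_mx e *m U) (e 0 k).
Proof.
move=> /unitarymxP UK; apply/eigenvalueP; exists (row k U).
  rewrite !mulmxA -row_mul UK row1 -rowE row_diag_mx.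
  by rewrite -scalemxAl -rowE.
apply/eqP => rU; have := congr1 (mulmx^~ (U ^t*)) rU.
rewrite mul0mx -row_mul UK => /rowP/(_ k)/eqP.
by rewrite !mxE eqxx oner_eq0.
Qed.

Lemma mxtrace_diag_mul {R : comNzRingType} (n : nat) (e : 'rV[R]_n) (M : 'M[R]_n) :
  \tr (diag_mx e *m M) = \sum_k e 0 k * M k k.
Proof. by apply: eq_bigr => k _; rewrite mul_diag_mx !mxE. Qed.

Lemma mulmx_unitary_conj {R : realType} (n : nat) (U X Y : 'M[R[i]]_n) :
  U \is unitarymx ->
  (U ^t* *m X *m U) *m (U ^t* *m Y *m U) = U ^t* *m (X *m Y) *m U.
Proof.
move=> /unitarymxP UK; rewrite !mulmxA; congr (_ *m U).
by rewrite -[_ *m U *m U ^t*]mulmxA UK mulmx1.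
Qed.

Lemma mulmx_unitary_conj3 {R : realType} (n : nat) (U X Y Z : 'M[R[i]]_n) :
  U \is unitarymx ->
  (U ^t* *m X *m U) *m (U ^t* *m Y *m U) *m (U ^t* *m Z *m U) =
  U ^t* *m (X *m Y *m Z) *m U.
Proof. by move=> Uu; rewrite !mulmx_unitary_conj. Qed.

Lemma mxtrace_unitary_conj {R : realType} (n : nat) (U X : 'M[R[i]]_n) :
  U \is unitarymx -> \tr (U ^t* *m X *m U) = \tr X.
Proof. by move=> /unitarymxP UK; rewrite mxtrace_mulC mulmxA UK mul1mx. Qed.

Lemma mxtrace_unitary_conj2 {R : realType} (n : nat) (U X Y : 'M[R[i]]_n) :
  U \is unitarymx ->
  \tr ((U ^t* *m X *m U) *m (U ^t* *m Y *m U)) = \tr (X *m Y).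
Proof. by move=> Uu; rewrite mulmx_unitary_conj// mxtrace_unitary_conj. Qed.

Lemma mxtrace_unitary_conj3 {R : realType} (n : nat) (U X Y Z : 'M[R[i]]_n) :
  U \is unitarymx ->
  \tr ((U ^t* *m X *m U) *m (U ^t* *m Y *m U) *m (U ^t* *m Z *m U)) =
  \tr (X *m Y *m Z).
Proof. by move=> Uu; rewrite mulmx_unitary_conj3// mxtrace_unitary_conj. Qed.

Theorem theorem4p4 (R : realType) (A B : 'M[R[i]]_2) (I : interval R)
    (f : R -> R) (s : R)
    (hA : psdmx A) (hB : psdmx B)
    (hspec : spec A `<=` [set x%:C | x in [set` I]])
    (f_ge0 : {in I, forall x, 0 <= f x})
    (f_nondecr : {in I &, {homo f : x y / x <= y}})
    (hs : 1 <= s) :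
  \tr (hermfun f A *m mxpow A s *m mxpow B s) >=
  \tr (hermfun f A *m mxpow (mxpow A (1 / 2) *m B *m mxpow A (1 / 2)) s).
Proof.
have [d d0 AE] := psdmx_spectral _ hA.
have Uu : spectralmx A \is unitarymx by exact: spectral_unitarymx.
move: (spectralmx A) Uu AE => U Uu AE.
have UK := unitarymxPl _ Uu; have /unitarymxP UK' := Uu.
(* The hypotheses on [f] hold only on [I], so its arguments must be shown to lie there. *)
have dI k : d 0 k \in I.
  have /hspec[x xI /complexI <-//] : spec A (d 0 k)%:C.
  rewrite /spec /= AE; have := eigenvalue_unitary_diag _ U
    (map_mx (real_complex R) d) k Uu.
  by rewrite mxE.
(* [B'] is [B] written in the eigenbasis of [A]. *)
have [B' Bp BE] : exists2 B', psdmx B' & B = U ^t* *m B' *m U.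
  exists (U *m B *m U ^t*); first exact: psdmx_conj.
  by rewrite !mulmxA UK mul1mx -mulmxA UK mulmx1.
have funA g : hermfun g A =
    U ^t* *m diag_mx (map_mx (fun x => (g x)%:C) d) *m U.
  exact: hermfunE Uu AE.
have powB : mxpow B s = U ^t* *m mxpow B' s *m U.
  by rewrite BE; exact: hermfun_conj Uu (proj1 Bp).
(* In the eigenbasis the outer factors are diagonal with entries the square roots of [d], so the
   product becomes [dcongr]. *)
have powC : mxpow (mxpow A (1 / 2) *m B *m mxpow A (1 / 2)) s =
    U ^t* *m mxpow (dcongr (d 0) B') s *m U.
  rewrite -(hermfun_conj _ _ _ Uu (dcongr_hermsymmx (d 0) B' (proj1 Bp))).
  congr (mxpow _ s); rewrite [mxpow A _]funA BE.
  apply: etrans (mulmx_unitary_conj3 _ _ _ _ _ Uu) _; congr (_ *m _ *m _).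
  apply/matrixP => k l; rewrite mul_mx_diag mxE mul_diag_mx !mxE.
  by rewrite div1r !powR12_sqrt.
have lhsE : \tr (hermfun f A *m mxpow A s *m mxpow B s) =
    \sum_k (f (d 0 k) * d 0 k `^ s)%:C * mxpow B' s k k.
  rewrite powB [mxpow A s]funA funA.
  apply: etrans (mxtrace_unitary_conj3 _ _ _ _ _ Uu) _.
  rewrite mulmx_diag mxtrace_diag_mul; apply: eq_bigr => k _.
  by congr (_ * _); rewrite !mxE rmorphM.
have rhsE : \tr (hermfun f A *m
      mxpow (mxpow A (1 / 2) *m B *m mxpow A (1 / 2)) s) =
    \sum_k (f (d 0 k))%:C * mxpow (dcongr (d 0) B') s k k.
  rewrite powC funA; apply: etrans (mxtrace_unitary_conj2 _ _ _ _ Uu) _.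
  by rewrite mxtrace_diag_mul; apply: eq_bigr => k _; congr (_ * _); rewrite mxE.
rewrite lhsE rhsE.
(* The spectral theorem gives no order of the eigenvalues; the index of the larger one is passed as
   [i]. *)
have [dle|/ltW dle] := leP (d 0 0) (d 0 1).
- rewrite !(sum_ord2 _ 1 0)//.
  apply: (trace_ineq_diag B' (d 0) (fun k => f (d 0 k))) => //.
    by rewrite d0.
  by rewrite f_ge0 ?f_nondecr.
- rewrite !(sum_ord2 _ 0 1)//.
  apply: (trace_ineq_diag B' (d 0) (fun k => f (d 0 k))) => //.
    by rewrite d0.
  by rewrite f_ge0 ?f_nondecr.
Qed.
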